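(* Let $U_0,\ldots,U_{n-1}$ be $m\times m$ real matrices such that $\mathcal{T}(U)$ is a subgenerator, and let $A=(A_i)_{i=0,\ldots,n-1}$ be such that $e^{\mathcal{T}(U)}=\mathcal{T}(A)$. Let $K\ge n$, let $U^{(K)}=(U_i^{(K)})_{i=0,\ldots,K-1}$ with $U_i^{(K)}=U_i$ for $0\le i\le n-1$ and $U_i^{(K)}=0$ for $n\le i\le K-1$, and let $S^{(K)}=(S_i^{(K)})_{i=0,\ldots,K-1}$ be such that $e^{\mathcal{C}(U^{(K)})}=\mathcal{C}(S^{(K)})$. Then $S_i^{(K)}-A_i\ge 0$ (entrywise) for $i=0,\ldots,n-1$, and $$\left\|\left[\,S_0^{(K)}-A_0\ \ \ldots\ \ S_{n-1}^{(K)}-A_{n-1}\,\right]\right\|_\infty\le f_K(\sigma)$$ for every $\sigma>1$, where $$f_K(\sigma)=(e^{\|L\|_\infty}-1)\,e^{\alpha(\sigma^{n-1}-1)}\,\frac{\sigma^{-K+n}}{1-\sigma^{-1}},\qquad \alpha=\max_j(-(U_0)_{j,j}).$$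
   Context: For a block-vector $B=(B_i)_{i=0,\ldots,N-1}$ of $m\times m$ matrices: $\mathcal{T}(B)$ is the $N\times N$ block upper triangular block-Toeplitz matrix whose $(i,j)$ block is $B_{j-i}$ if $j\ge i$ and $0$ if $j<i$; $\mathcal{C}(B)$ is the $N\times N$ block-circulant matrix whose $(i,j)$ block is $B_{(j-i)\bmod N}$. Both classes are closed under multiplication and exponentiation. $L$ is the $n\times n$ block strictly lower triangular matrix (with $m\times m$ blocks) whose $(i,j)$ block is $U_{n+j-i}$ if $j<i$ and $0$ if $j\ge i$. A subgenerator is a real square matrix whose off-diagonal entries are nonnegative, whose diagonal entries are negative, and whose row sums are all nonpositive. $\|\cdot\|_\infty$ is the matrix norm induced by the vector infinity norm (maximum absolute row sum, also for rectangular matrices). *)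

(* Defs.v *)
From mathcomp Require Import all_boot all_order all_algebra.
From mathcomp Require Import all_classical all_reals all_analysis.

Set Implicit Arguments.
Unset Strict Implicit.
Unset Printing Implicit Defensive.

Import Order.TTheory GRing.Theory Num.Theory.
Import numFieldNormedType.Exports.

Local Open Scope ring_scope.

Definition expmx (R : realType) (N : nat) (M : 'M[R]_N) : 'M[R]_N :=
  limn (series (fun k : nat => (k`!%:R)^-1 *: (M ^+ k : 'M[R]_N))).

(* Maximum absolute row sum, i.e. the operator norm induced by the vector
   infinity norm (and not the entrywise norm carried by 'M[R]_(p, q)). *)
Definition normInf (R : realType) (p q : nat) (M : 'M[R]_(p, q)) : R :=
  \big[Num.max/(0 : R)]_(i < p) \sum_(j < q) (`|M i j| : R).

Definition subgenerator (R : realType) (N : nat) (M : 'M[R]_N) : Prop :=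
  [/\ forall i j : 'I_N, i != j -> 0 <= M i j,
      forall i : 'I_N, M i i < 0 &
      forall i : 'I_N, \sum_(j < N) M i j <= 0].

(* The k-th block of B, extended by 0 for k >= N. *)
Definition blk (R : realType) (m N : nat) (B : 'I_N -> 'M[R]_m) (k : nat) :
    'M[R]_m :=
  if insub k is Some i then B i else 0.

Definition btoep (R : realType) (m N : nat) (B : 'I_N -> 'M[R]_m) :
    'M[R]_(\sum_(i < N) m) :=
  \mxblock_(i < N, j < N) (if (i <= j)%N then blk B (j - i) else 0).

(* (j + N - i) %% N is (j - i) mod N without truncation, as i < N. *)
Definition bcirc (R : realType) (m N : nat) (B : 'I_N -> 'M[R]_m) :
    'M[R]_(\sum_(i < N) m) :=
  \mxblock_(i < N, j < N) blk B ((j + N - i) %% N).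

Definition wrapL (R : realType) (m n : nat) (U : 'I_n -> 'M[R]_m) :
    'M[R]_(\sum_(i < n) m) :=
  \mxblock_(i < n, j < n) (if (j < i)%N then blk U (n + j - i) else 0).

Definition zero_ext (R : realType) (m n K : nat) (U : 'I_n -> 'M[R]_m) :
    'I_K -> 'M[R]_m :=
  fun i => blk U i.

Arguments zero_ext {R m n} K U _.

(* The default value 0 of the maximum is immaterial: diagonal entries of a
   subgenerator are negative, so for m > 0 this is the maximum over j. *)
Definition max_neg_diag (R : realType) (m : nat) (M : 'M[R]_m) : R :=
  \big[Num.max/(0 : R)]_(j < m) (- M j j).

Definition fbound (R : realType) (m n K : nat) (U : 'I_n -> 'M[R]_m)
    (n_gt0 : (0 < n)%N) (s : R) : R :=
  let alpha := max_neg_diag (U (Ordinal n_gt0)) in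
  (expR (normInf (wrapL U)) - 1) * expR (alpha * (s ^+ n.-1 - 1)) *
  (s ^ (- K%:Z + n%:Z) / (1 - s^-1)).

(* Main.v *)
Require Import Defs.
From mathcomp Require Import all_boot all_order all_algebra.
From mathcomp Require Import all_classical all_reals all_analysis.
From mathcomp Require Import ring lra zify.

Set Implicit Arguments.
Unset Strict Implicit.
Unset Printing Implicit Defensive.

Import Order.TTheory GRing.Theory Num.Theory.
Import numFieldNormedType.Exports.

(** Let T be the K x K block triangular Toeplitz matrix built on U^(K), and
    C = T + H the block-circulant one. T extends the n x n block matrix and is
    block triangular, so the first n blocks of the first block row of e^C - e^T
    are the S_i - A_i. By Euler's formula e^M = lim (1 + M/p)^p, it suffices to
    compare the powers of F = 1 + T/p and F + H/p, which are nonnegative for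
    large p. Let w have i-th block s^i 1 and let b = alpha (s^(n-1) - 1). Then
    (F + H/p) 1 <= 1, F w <= (1 + b/p) w and H 1 <= h w, where
    h = ||L|| s^(n-K). By induction,
    ((F + H/p)^k - F^k) 1 <= h (k/p) (1 + b/p)^k w; taking k = p and letting p
    grow bounds (e^C - e^T) 1 by h e^b w, and w is 1 on the first block. The
    bound f_K(s) then follows from ||L|| <= e^||L|| - 1 and 1 <= 1/(1 - 1/s). *)

Local Open Scope ring_scope.
Local Open Scope classical_set_scope.

(** * Entrywise convergence of the matrix exponential and Euler's formula *)

Lemma abs_rowsum_mxX (R : realType) (N : nat) (M : 'M[R]_N) (k : nat)
    (i : 'I_N) :
  \sum_j `|(M ^+ k) i j| <= (\sum_i \sum_j `|M i j|) ^+ k.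
Proof.
set r := \sum_i \sum_j _.
have r_ge0 : 0 <= r by do 2!apply: sumr_ge0 => ? _.
elim: k i => [|k IHk] i.
  rewrite expr0 (bigD1 i) //= big1 => [|j ji]; rewrite mxE ?eqxx ?normr1 ?addr0 //.
  by rewrite eq_sym (negbTE ji) normr0.
rewrite exprS.
apply: (@le_trans _ _ (\sum_l `|M i l| * \sum_j `|(M ^+ k) l j|)).
  under [leRHS]eq_bigr do rewrite mulr_sumr.
  rewrite exchange_big /=; apply: ler_sum => j _; rewrite mxE.
  by apply: le_trans (ler_norm_sum _ _ _) _; apply: ler_sum => l _; rewrite normrM.
rewrite exprS.
apply: (@le_trans _ _ (\sum_l `|M i l| * r ^+ k)).
  by apply: ler_sum => l _; rewrite ler_wpM2l.
rewrite -mulr_suml ler_wpM2r ?exprn_ge0 // [leRHS](bigD1 i) //= lerDl.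
by do 2!apply: sumr_ge0 => ? _.
Qed.

Lemma abs_mxX (R : realType) (N : nat) (M : 'M[R]_N) (k : nat) (i j : 'I_N) :
  `|(M ^+ k) i j| <= (\sum_i \sum_j `|M i j|) ^+ k.
Proof.
apply: le_trans (abs_rowsum_mxX M k i).
by rewrite (bigD1 j) //= lerDl sumr_ge0.
Qed.

Lemma series_exp_coeff_le (R : realType) (x : R) (n : nat) :
  0 <= x -> series (exp_coeff x) n <= expR x.
Proof.
move=> x_ge0; apply: nondecreasing_cvgn_le (is_cvg_series_exp_coeff x) n.
by apply: nondecreasing_series => k _ _; exact: exp_coeff_ge0.
Qed.

Lemma cvg_mx_coord (R : realType) (m n : nat) (F : nat -> 'M[R]_(m, n))
    (L : 'M[R]_(m, n)) :
  (forall i j, (fun p => F p i j) @ \oo --> (L i j : R)) -> F @ \oo --> L.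
Proof.
move=> cvF; apply/cvg_ballP => e e_gt0; near=> p; split=> //.
near: p; apply: filter_forall => i; apply: filter_forall => j.
by move/cvg_ballP: (cvF i j); exact.
Unshelve. all: by end_near. Qed.

(** [expmx] is a [limn], which says nothing until convergence is known. Each entry is dominated by
    the scalar exponential series at [r], the sum of all absolute entries, because [M ^+ k] is
    entrywise at most [r ^+ k]. *)
Lemma is_cvg_expmx (R : realType) (N : nat) (M : 'M[R]_N) :
  cvgn (series (fun k => k`!%:R^-1 *: (M ^+ k : 'M[R]_N))).
Proof.
set r := \sum_i \sum_j `|M i j|.
have r_ge0 : 0 <= r by do 2!apply: sumr_ge0 => ? _.
have cv i j : cvgn (series (fun k => k`!%:R^-1 * (M ^+ k) i j)).
  apply: normed_cvg; apply: (@series_le_cvg _ _ (exp_coeff r)).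
  - by move=> k /=.
  - by move=> k; exact: exp_coeff_ge0.
  - move=> k /=; rewrite normrM ger0_norm ?invr_ge0 // mulrC.
    by rewrite ler_wpM2r ?invr_ge0 // abs_mxX.
  - exact: is_cvg_series_exp_coeff.
apply/cvg_ex.
exists (\matrix_(i, j) limn (series (fun k => k`!%:R^-1 * (M ^+ k) i j))).
apply: cvg_mx_coord => i j; rewrite mxE; apply: cvg_trans (cv i j).
apply: near_eq_cvg; near=> p.
by rewrite /= /series /= summxE; apply: eq_bigr => k _; rewrite mxE.
Unshelve. all: by end_near. Qed.

Lemma cvg_expmx (R : realType) (N : nat) (M : 'M[R]_N) (i j : 'I_N) :
  (fun p => \sum_(0 <= k < p) k`!%:R^-1 * (M ^+ k) i j) @ \oo
    --> (expmx M i j : R).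
Proof.
have := cvg_comp _ _ (@is_cvg_expmx R N M) (@coord_continuous R N N i j _).
apply: cvg_trans; apply: near_eq_cvg; near=> p.
by rewrite /= /series /= summxE; apply: eq_bigr => k _; rewrite mxE.
Unshelve. all: by end_near. Qed.

(** The ratio compares the k-th coefficient of (1 + x/N)^N with 1/k!. The bound is geometric in k,
    so that its sum against r^k/k! is still controlled, by e^(2r)/N. *)
Lemma ffact_ratio_bounds (R : realType) (N k : nat) : (0 < N)%N ->
  0 <= 1 - (N ^_ k)%:R / N%:R ^+ k :> R /\
  1 - (N ^_ k)%:R / N%:R ^+ k <= 2 ^+ k / N%:R :> R.
Proof.
move=> N_gt0; have N0 : 0 < N%:R :> R by rewrite ltr0n.
have NV0 : 0 <= N%:R^-1 :> R by rewrite invr_ge0 ltW.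
elim: k => [|k [IH1 IH2]].
  by rewrite ffactn0 !expr0 divr1 subrr lexx mul1r.
have [lt_Nk|le_kN] := ltnP N k.+1.
  (* The falling factorial vanishes here, and what remains is N <= 2^(k+1). *)
  rewrite ffact_small // mul0r subr0; split=> //; rewrite ler_pdivlMr // mul1r.
  apply: (@le_trans _ _ k.+1%:R); first by rewrite ler_nat ltnW.
  by rewrite -natrX ler_nat ltnW // ltn_expl.
rewrite ffactnSr natrM natrB 1?ltnW // exprSr.
set x := (N ^_ k)%:R / N%:R ^+ k in IH1 IH2.
have -> : (N ^_ k)%:R * (N%:R - k%:R) / (N%:R ^+ k * N%:R) =
    x * (1 - k%:R / N%:R) :> R.
  by rewrite /x; field; rewrite expf_neq0 ?gt_eqF.
set y := k%:R / N%:R; have y0 : 0 <= y by rewrite divr_ge0.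
have y1 : y <= 1 by rewrite ler_pdivrMr // mul1r ler_nat ltnW.
have x0 : 0 <= x by rewrite divr_ge0 // exprn_ge0.
have y2 : y <= 2 ^+ k / N%:R.
  by rewrite ler_wpM2r // -natrX ler_nat ltnW // ltn_expl.
rewrite exprS -mulrA; set z := 2 ^+ k / N%:R in IH2 y2 *.
(* The upper bound is 1 - x(1 - y) = (1 - x) + xy <= z + y <= 2z. *)
by split; nra.
Qed.

Lemma scalemxX (R : comPzRingType) (N : nat) (a : R) (M : 'M[R]_N) (k : nat) :
  (a *: M) ^+ k = a ^+ k *: M ^+ k.
Proof.
elim: k => [|k IHk]; first by rewrite !expr0 scale1r.
by rewrite !exprS IHk /GRing.mul /= -scalemxAl -scalemxAr scalerA.
Qed.

(** The binomial expansion is compared term by term with a partial exponential sum: the k-th terms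
    differ by at most (2r)^k / (k! (p+1)), hence the sums by e^(2r)/(p+1). The shift to [p.+1]
    avoids a division by 0. *)
Lemma cvg_euler_expmx (R : realType) (N : nat) (M : 'M[R]_N) (i j : 'I_N) :
  (fun p => ((p.+1%:R^-1 *: M + 1) ^+ p.+1) i j) @ \oo --> (expmx M i j : R).
Proof.
set r := \sum_i \sum_j `|M i j|.
have r_ge0 : 0 <= r by do 2!apply: sumr_ge0 => ? _.
(* The expansion of a power [p.+1] has [p.+2] terms, so the partial sum is cut there. *)
have cvg_e : (fun p => \sum_(0 <= k < p.+2) k`!%:R^-1 * (M ^+ k) i j) @ \oo
    --> (expmx M i j : R).
  have := @cvg_expmx R N M i j; rewrite -(cvg_shiftn 2).
  by under eq_fun do rewrite addn2.
have cvg0 : (fun p => p.+1%:R^-1 * expR (2 * r)) @ \oo --> (0 : R).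
  rewrite -[X in _ --> X](mul0r (expR (2 * r))).
  by apply: cvgMl; exact: cvg_harmonic.
have dist_le p : `|((p.+1%:R^-1 *: M + 1) ^+ p.+1) i j -
    \sum_(0 <= k < p.+2) k`!%:R^-1 * (M ^+ k) i j| <= p.+1%:R^-1 * expR (2 * r).
  rewrite exprD1n summxE big_mkord -sumrB.
  apply: (@le_trans _ _ (\sum_(k < p.+2) p.+1%:R^-1 * exp_coeff (2 * r) k)).
    apply: le_trans (ler_norm_sum _ _ _) _; apply: ler_sum => k _.
    rewrite scalemxX mulmxnE mxE.
    have f0 : k`!%:R != 0 :> R by rewrite pnatr_eq0 -lt0n fact_gt0.
    have P0 : p.+1%:R ^+ k != 0 :> R by rewrite expf_neq0.
    have -> : p.+1%:R^-1 ^+ k * (M ^+ k) i j *+ 'C(p.+1, k) -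
        k`!%:R^-1 * (M ^+ k) i j =
        - (k`!%:R^-1 * (1 - (p.+1 ^_ k)%:R / p.+1%:R ^+ k) * (M ^+ k) i j).
      by rewrite -bin_ffact natrM exprVn -mulr_natr; field; rewrite f0 P0.
    have [q0 q1] := @ffact_ratio_bounds R p.+1 k isT.
    rewrite normrN !normrM ger0_norm ?invr_ge0 // (ger0_norm q0).
    apply: (@le_trans _ _ (k`!%:R^-1 * (2 ^+ k / p.+1%:R) * r ^+ k)).
      apply: ler_pM; rewrite ?mulr_ge0 ?invr_ge0 //.
        by rewrite ler_wpM2l ?invr_ge0.
      exact: abs_mxX.
    by rewrite /exp_coeff /= exprMn le_eqVlt; apply/orP; left; apply/eqP; ring.
  rewrite -mulr_sumr ler_wpM2l ?invr_ge0 //.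
  have := @series_exp_coeff_le R (2 * r) p.+2 (mulr_ge0 (ler0n _ _) r_ge0).
  by rewrite /series /= big_mkord.
have cvd : (fun p => ((p.+1%:R^-1 *: M + 1) ^+ p.+1) i j -
    \sum_(0 <= k < p.+2) k`!%:R^-1 * (M ^+ k) i j) @ \oo --> (0 : R).
  apply: norm_cvg0; apply: squeeze_cvgr (cvg_cst _) cvg0.
  by near=> p; rewrite normr_ge0 /=.
rewrite -[X in _ --> X]add0r; apply: cvg_trans (cvgD cvd cvg_e).
by apply: near_eq_cvg; near=> p; rewrite /= subrK.
Unshelve. all: by end_near. Qed.

(** * Row sums of powers and exponentials under a nonnegative perturbation *)

Lemma rowsum_mulmx (R : comPzRingType) (m n p : nat) (A : 'M[R]_(m, n))
    (B : 'M[R]_(n, p)) (i : 'I_m) :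
  \sum_j (A *m B) i j = \sum_l A i l * \sum_j B l j.
Proof.
under eq_bigr do rewrite mxE.
by rewrite exchange_big; apply: eq_bigr => l _; rewrite mulr_sumr.
Qed.

(** Commutativity is not assumed. With the leftmost factor split off, row sums of the first term
    reduce to those of a power of [x + y], and those of the second to the previous difference. *)
Lemma exprS_perturb (R : pzRingType) (x y : R) (k : nat) :
  (x + y) ^+ k.+1 - x ^+ k.+1 = y * (x + y) ^+ k + x * ((x + y) ^+ k - x ^+ k).
Proof. by rewrite !exprS mulrDl mulrBr addrA [y * _ + _]addrC. Qed.

Section PowerComparison.
Context {R : realFieldType} {N : nat} {F H : 'M[R]_N} {w : 'I_N -> R} {h c : R}.
Hypotheses (F_ge0 : forall i j, 0 <= F i j) (H_ge0 : forall i j, 0 <= H i j).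

Lemma le_mxX_perturb k i j :
  0 <= (F ^+ k) i j /\ (F ^+ k) i j <= ((F + H) ^+ k) i j.
Proof.
elim: k i j => [|k IHk] i j; first by rewrite lexx mxE ler0n.
rewrite !exprS /GRing.mul /= !mxE; split.
  by apply: sumr_ge0 => l _; have [? _] := IHk l j; rewrite mulr_ge0.
apply: ler_sum => l _; have [? ?] := IHk l j.
by rewrite mxE ler_pM // lerDl.
Qed.

Hypothesis FH1 : forall i, \sum_j (F + H) i j <= 1.

Lemma rowsum_mxX_le1 k i : \sum_j ((F + H) ^+ k) i j <= 1.
Proof.
elim: k i => [|k IHk] i.
  rewrite expr0 (bigD1 i) //= big1 => [|j ji]; rewrite mxE ?eqxx ?addr0 //.
  by rewrite eq_sym (negbTE ji).
rewrite exprS /GRing.mul /= rowsum_mulmx; apply: le_trans (FH1 i).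
apply: ler_sum => l _; rewrite -[leRHS]mulr1 ler_wpM2l //.
by rewrite mxE addr_ge0.
Qed.

Hypotheses (w_ge0 : forall i, 0 <= w i) (h_ge0 : 0 <= h) (c_ge1 : 1 <= c).
Hypotheses (Fw : forall i, \sum_j F i j * w j <= c * w i).
Hypotheses (H1 : forall i, \sum_j H i j <= h * w i).

(** By [exprS_perturb]: H (F + H)^k 1 <= H 1 <= h w, as powers of F + H have row sums at most 1,
    while F turns the inductive bound h k c^k w into h k c^(k+1) w. *)
Lemma rowsum_mxX_perturb k i :
  \sum_j ((F + H) ^+ k - F ^+ k) i j <= h * k%:R * c ^+ k * w i.
Proof.
elim: k i => [|k IHk] i.
  by rewrite subrr mulr0 !mul0r big1 // => j _; rewrite mxE.
have -> : h * k.+1%:R * c ^+ k.+1 * w i =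
    h * w i * c ^+ k.+1 + h * k%:R * c ^+ k * (c * w i).
  by rewrite -natr1 exprS; ring.
rewrite exprS_perturb.
under eq_bigr do rewrite mxE.
rewrite big_split !rowsum_mulmx.
have c_ge0 : 0 <= c := le_trans ler01 c_ge1.
apply: lerD.
  (* The factor c^(k+1) >= 1 only brings this term to the form of the other one. *)
  apply: (@le_trans _ _ (h * w i)); last first.
    by rewrite ler_peMr ?mulr_ge0 // exprn_ege1.
  apply: le_trans (H1 i); apply: ler_sum => l _.
  by rewrite -[leRHS]mulr1 ler_wpM2l // rowsum_mxX_le1.
apply: (@le_trans _ _ (\sum_l h * k%:R * c ^+ k * (F i l * w l))).
  by apply: ler_sum => l _; rewrite mulrCA ler_wpM2l.
by rewrite -mulr_sumr ler_wpM2l // !mulr_ge0 // exprn_ge0.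
Qed.

End PowerComparison.

Lemma rowsum_scaleD1 (R : comPzRingType) (N : nat) (a : R) (M : 'M[R]_N)
    (v : 'I_N -> R) (i : 'I_N) :
  \sum_j (a *: M + 1) i j * v j = a * (\sum_j M i j * v j) + v i.
Proof.
transitivity (\sum_j (a * (M i j * v j) + (i == j)%:R * v j)).
  by apply: eq_bigr => j _; rewrite !mxE mulrDl mulrA.
rewrite big_split -mulr_sumr; congr (_ + _).
rewrite (bigD1 i) //= eqxx mul1r big1 ?addr0 // => j ji.
by rewrite eq_sym (negbTE ji) mul0r.
Qed.

(** The comparison of powers is applied to 1 + T/(p+1) and H/(p+1) with exponent p+1. Its final
    bound does not depend on p, so it survives the limit in Euler's formula. *)
Lemma rowsum_expmx_perturb (R : realType) (N : nat) (T H : 'M[R]_N)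
    (w : 'I_N -> R) (h b : R) :
  (forall i j, i != j -> 0 <= T i j) ->
  (forall i j, 0 <= H i j) ->
  (forall i, \sum_j (T + H) i j <= 0) ->
  (forall i, 0 <= w i) -> 0 <= h -> 0 <= b ->
  (forall i, \sum_j T i j * w j <= b * w i) ->
  (forall i, \sum_j H i j <= h * w i) ->
  (forall i j, expmx T i j <= expmx (T + H) i j) /\
  (forall i, \sum_j (expmx (T + H) i j - expmx T i j) <= h * expR b * w i).
Proof.
move=> T_ge0 H_ge0 TH1 w_ge0 h_ge0 b_ge0 Tw H1.
have cvTH := @cvg_euler_expmx R N (T + H); have cvT := @cvg_euler_expmx R N T.
(* Only the diagonal of [T] can be negative; from [p0] on, the identity compensates for it in
   [F p]. *)
have [p0 p0P] : exists p0 : nat, forall p i, (p0 <= p)%N -> - T i i <= p.+1%:R.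
  exists (Num.bound (\sum_i `|T i i|)) => p i le_p.
  apply: (@le_trans _ _ (\sum_i `|T i i|)).
    rewrite (bigD1 i) //=; apply: le_trans (ler_norm _) _.
    by rewrite normrN lerDl sumr_ge0.
  apply: ltW; apply: lt_le_trans (archi_boundP _) _; first exact: sumr_ge0.
  by rewrite ler_nat ltnW.
pose F p : 'M[R]_N := p.+1%:R^-1 *: T + 1.
pose Hp p : 'M[R]_N := p.+1%:R^-1 *: H.
have FHE p : p.+1%:R^-1 *: (T + H) + 1 = F p + Hp p by rewrite scalerDr addrAC.
have pV p : 0 <= p.+1%:R^-1 :> R by rewrite invr_ge0.
have F_ge0 p : (p0 <= p)%N -> forall i j, 0 <= F p i j.
  move=> le_p i j; rewrite !mxE; have [<-|ij] := eqVneq i j; last first.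
    by rewrite addr0 mulr_ge0 // T_ge0.
  by rewrite -lerBlDr sub0r ler_pdivlMl ?ltr0n // mulrN1 lerNl p0P.
have Hp_ge0 p i j : 0 <= Hp p i j by rewrite mxE mulr_ge0.
split=> [i j|i].
  apply: ler_cvg_to (cvT i j) (cvTH i j) _.
  near=> p; rewrite FHE.
  have le_p : (p0 <= p)%N by near: p; exact: nbhs_infty_ge.
  by have [] := le_mxX_perturb (F_ge0 p le_p) (Hp_ge0 p) p.+1 i j.
have cvs : (fun p => \sum_j (((p.+1%:R^-1 *: (T + H) + 1) ^+ p.+1) i j -
    ((p.+1%:R^-1 *: T + 1) ^+ p.+1) i j)) @ \oo -->
    \sum_j (expmx (T + H) i j - expmx T i j).
  by apply: cvg_big => [|j _]; [exact: add_continuous|exact: cvgB].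
apply: ler_cvg_to cvs (cvg_cst _) _.
near=> p; rewrite FHE -/(F p).
have le_p : (p0 <= p)%N by near: p; exact: nbhs_infty_ge.
have c_ge1 : 1 <= 1 + b / p.+1%:R by rewrite lerDl mulr_ge0.
have FH1 l : \sum_j (F p + Hp p) l j <= 1.
  have := rowsum_scaleD1 p.+1%:R^-1 (T + H) (fun=> 1) l.
  under eq_bigr do rewrite mulr1.
  rewrite FHE => ->; rewrite gerDr mulr_ge0_le0 //.
  by under eq_bigr do rewrite mulr1.
have Fw l : \sum_j F p l j * w j <= (1 + b / p.+1%:R) * w l.
  rewrite rowsum_scaleD1 mulrDl mul1r addrC lerD2l mulrAC [leRHS]mulrC.
  by rewrite ler_wpM2l.
have HpH l : \sum_j Hp p l j <= (h / p.+1%:R) * w l.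
  under eq_bigr do rewrite mxE.
  by rewrite -mulr_sumr mulrAC [leRHS]mulrC ler_wpM2l.
have hp_ge0 : 0 <= h / p.+1%:R by rewrite mulr_ge0.
have := rowsum_mxX_perturb (F_ge0 p le_p) (Hp_ge0 p) FH1 w_ge0 hp_ge0 c_ge1
  Fw HpH p.+1 i.
under eq_bigr do rewrite 2!mxE.
(* The factor [p.+1] cancels the denominator of h/(p+1), and (1 + b/(p+1))^(p+1) <= e^b follows from
   1 + x <= e^x. *)
move/le_trans; apply; rewrite divfK // ler_wpM2r // ler_wpM2l //.
apply: (@le_trans _ _ (expR (b / p.+1%:R) ^+ p.+1)).
  by rewrite lerXn2r ?nnegrE ?expR_ge0 ?expR_ge1Dx // (le_trans ler01).
by rewrite -expRM_natr divfK.
Unshelve. all: by end_near. Qed.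

(** * Restriction of powers and exponentials to an invariant set of coordinates *)

Lemma big_inj_codom (V : nmodType) (p q : nat) (f : 'I_p -> 'I_q)
    (g : 'I_q -> V) :
  injective f -> \sum_s g (f s) = \sum_(u | u \in codom f) g u.
Proof.
move=> f_inj; rewrite -big_uniq /=; last by rewrite map_inj_uniq // enum_uniq.
by rewrite codomE big_map big_enum.
Qed.

(** The vanishing hypothesis says that the coordinate subspace indexed by the image of [f] is stable
    under [M]; [N] is the restriction of [M] to it, and restriction commutes with powers. *)
Lemma mxX_inj_sub (R : comPzRingType) (p q : nat) (f : 'I_p -> 'I_q)
    (M : 'M[R]_q) (N : 'M[R]_p) :
  injective f ->
  (forall u t, u \notin codom f -> M u (f t) = 0) ->
  (forall s t, M (f s) (f t) = N s t) ->
  forall k s t, (M ^+ k) (f s) (f t) = (N ^+ k) s t.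
Proof.
move=> f_inj M0 MN; elim=> [|k IHk] s t.
  by rewrite !mxE (inj_eq f_inj).
rewrite !exprSr /GRing.mul /= !mxE (bigID (mem (codom f))) /=.
rewrite [X in _ + X]big1 ?addr0 => [|u /M0 ->]; last by rewrite mulr0.
rewrite -(big_inj_codom (fun u => (M ^+ k) (f s) u * M u (f t)) f_inj).
by apply: eq_bigr => u _; rewrite IHk MN.
Qed.

Lemma expmx_inj_sub (R : realType) (p q : nat) (f : 'I_p -> 'I_q)
    (M : 'M[R]_q) (N : 'M[R]_p) :
  injective f ->
  (forall u t, u \notin codom f -> M u (f t) = 0) ->
  (forall s t, M (f s) (f t) = N s t) ->
  forall s t, expmx M (f s) (f t) = expmx N s t.
Proof.
move=> f_inj M0 MN s t.
have cvM := @cvg_expmx R q M (f s) (f t).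
have cvN := @cvg_expmx R p N s t.
apply: (cvg_unique _ cvM) => //; apply: cvg_trans cvN.
apply: near_eq_cvg; near=> k; apply: eq_bigr => l _.
by rewrite (mxX_inj_sub f_inj M0 MN).
Unshelve. all: by end_near. Qed.

(** * Block coordinates *)

Definition bidx (m N : nat) (i : 'I_N) (a : 'I_m) : 'I_(\sum_(i < N) m) :=
  tagnat.Rank (p_ := fun=> m) i a.

Definition blkrow (m N : nat) (s : 'I_(\sum_(i < N) m)) : 'I_N := tagnat.sig1 s.

(** The type of [tagnat.sig2] depends on the block; as all blocks have size [m], it converts to
    ['I_m]. *)
Definition inrow (m N : nat) (s : 'I_(\sum_(i < N) m)) : 'I_m := tagnat.sig2 s.

Lemma blkrow_bidx m N (i : 'I_N) (a : 'I_m) : blkrow (bidx i a) = i.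
Proof. exact: tagnat.Rank1K. Qed.

Lemma inrow_bidx m N (i : 'I_N) (a : 'I_m) : inrow (bidx i a) = a.
Proof.
by apply: val_inj; rewrite /inrow /bidx (tagnat.Rank2K (p_ := fun=> m)).
Qed.

Lemma bidxK m N (s : 'I_(\sum_(i < N) m)) : bidx (blkrow s) (inrow s) = s.
Proof. exact: tagnat.sig2K. Qed.

Lemma big_bidx (V : nmodType) m N (g : 'I_N -> 'I_m -> V) :
  \sum_(s < \sum_(i < N) m) g (blkrow s) (inrow s) = \sum_i \sum_a g i a.
Proof.
rewrite pair_big /= [RHS](reindex (fun s => (blkrow s, inrow s))) //=.
exists (fun ia => bidx ia.1 ia.2) => [s _|[i a] _] /=; first exact: bidxK.
by rewrite blkrow_bidx inrow_bidx.
Qed.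

Lemma blk_ord (R : realType) m N (B : 'I_N -> 'M[R]_m) (i : 'I_N) :
  blk B i = B i.
Proof. by rewrite /blk valK. Qed.

Lemma blk_oversize (R : realType) m N (B : 'I_N -> 'M[R]_m) k :
  (N <= k)%N -> blk B k = 0.
Proof. by move=> le_Nk; rewrite /blk insubF // ltnNge le_Nk. Qed.

Lemma blk_zero_ext (R : realType) m n K (U : 'I_n -> 'M[R]_m) k :
  (n <= K)%N -> blk (zero_ext K U) k = blk U k.
Proof.
move=> le_nK; have [lt_kK|le_Kk] := ltnP k K.
  by rewrite -[k]/(val (Ordinal lt_kK)) blk_ord.
by rewrite !blk_oversize // (leq_trans le_nK).
Qed.

Lemma btoepE (R : realType) m N (B : 'I_N -> 'M[R]_m) s t :
  btoep B s t = (if (blkrow s <= blkrow t)%N then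
    blk B (blkrow t - blkrow s) (inrow s) (inrow t) else 0).
Proof. by rewrite mxE; case: ifP => // _; rewrite mxE. Qed.

Lemma bcircE (R : realType) m N (B : 'I_N -> 'M[R]_m) s t :
  bcirc B s t = blk B ((blkrow t + N - blkrow s) %% N) (inrow s) (inrow t).
Proof. by rewrite mxE. Qed.

Lemma wrapLE (R : realType) m n (U : 'I_n -> 'M[R]_m) s t :
  wrapL U s t = (if (blkrow t < blkrow s)%N then
    blk U (n + blkrow t - blkrow s) (inrow s) (inrow t) else 0).
Proof. by rewrite mxE; case: ifP => // _; rewrite mxE. Qed.

Lemma normInf_rowsum (R : realType) p q (M : 'M[R]_(p, q)) i :
  \sum_j M i j <= normInf M.
Proof.
apply: (@le_trans _ _ (\sum_j `|M i j|)).
  by apply: ler_sum => j _; exact: ler_norm.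
exact: le_bigmax.
Qed.

Lemma normInf_ge0 (R : realType) p q (M : 'M[R]_(p, q)) : 0 <= normInf M.
Proof. exact: bigmax_ge_id. Qed.

(** * Row sums of the Toeplitz, circulant and wrapped matrices *)

Lemma big_nat_oversize (V : nmodType) (n K : nat) (g : nat -> V) :
  (n <= K)%N -> (forall k, (n <= k)%N -> g k = 0) ->
  \sum_(0 <= k < K) g k = \sum_(0 <= k < n) g k.
Proof.
move=> le_nK g0; rewrite (big_cat_nat (leq0n _) le_nK) /= [X in _ + X]big_nat.
by rewrite [X in _ + X]big1 ?addr0 // => k /andP[/g0].
Qed.

Lemma sum_cyclic_shift (V : nmodType) (K i : nat) (g : nat -> V) : (i < K)%N ->
  \sum_(j < K) g ((j + K - i) %% K)%N = \sum_(0 <= l < K) g l.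
Proof.
move=> lt_iK; have K_gt0 : (0 < K)%N by exact: leq_ltn_trans lt_iK.
pose phi (j : 'I_K) := Ordinal (ltn_pmod (j + K - i) K_gt0).
rewrite big_mkord [RHS](reindex phi) //; apply: onW_bij; apply: injF_bij.
move=> j j' /(congr1 val) /= /eqP.
rewrite -!addnBA 1?ltnW // eqn_modDr !modn_small // => /eqP; exact: val_inj.
Qed.

Section BlockSubgenerator.
Context {R : realType} {m n : nat} {U : 'I_n -> 'M[R]_m}.
Hypotheses (n_gt0 : (0 < n)%N) (hU : subgenerator (btoep U)).

Let rsum k (a : 'I_m) := \sum_b blk U k a b.

(** The first block row displays every block of [U], which is how sign conditions on the large
    matrix reach the single blocks. *)
Lemma btoep_first_blkrow k (lt_kn : (k < n)%N) a b :
  btoep U (bidx (Ordinal n_gt0) a) (bidx (Ordinal lt_kn) b) = blk U k a b.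
Proof. by rewrite btoepE !blkrow_bidx !inrow_bidx subn0. Qed.

(** The side condition excludes exactly the diagonal entries of the block 0, the only ones lying on
    the diagonal of [btoep U]. *)
Lemma blk_ge0 k a b : (0 < k)%N || (a != b) -> 0 <= blk U k a b.
Proof.
have [lt_kn|le_nk] := ltnP k n; last by rewrite blk_oversize ?mxE.
case: hU => U_ge0 _ _ kab; rewrite -(btoep_first_blkrow lt_kn).
apply: U_ge0; apply: contraTneq kab => e.
have := congr1 (@blkrow m n) e; have := congr1 (@inrow m n) e.
by rewrite !blkrow_bidx !inrow_bidx => -> [<-]; rewrite eqxx.
Qed.

Lemma rsum_ge0 k a : (0 < k)%N -> 0 <= rsum k a.
Proof. by move=> k_gt0; apply: sumr_ge0 => b _; rewrite blk_ge0 ?k_gt0. Qed.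

Lemma rsum_oversize k a : (n <= k)%N -> rsum k a = 0.
Proof.
by move=> le_nk; rewrite /rsum big1 // => b _; rewrite blk_oversize // mxE.
Qed.

Lemma sum_rsum_le0 a : \sum_(0 <= k < n) rsum k a <= 0.
Proof.
case: hU => _ _ /(_ (bidx (Ordinal n_gt0) a)); apply: le_trans.
under [leRHS]eq_bigr do rewrite btoepE blkrow_bidx inrow_bidx leq0n subn0.
by rewrite (big_bidx (fun i b => blk U i a b)) big_mkord.
Qed.

Lemma max_neg_diag_ge0 : 0 <= max_neg_diag (U (Ordinal n_gt0)).
Proof. exact: bigmax_ge_id. Qed.

Lemma oppr_rsum0_le a : - rsum 0 a <= max_neg_diag (U (Ordinal n_gt0)).
Proof.
rewrite /rsum (bigD1 a) //= opprD -[blk U 0]/(blk U (Ordinal n_gt0)) blk_ord.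
apply: (@le_trans _ _ (- U (Ordinal n_gt0) a a)).
  rewrite gerDl oppr_le0; apply: sumr_ge0 => b ba.
  by rewrite -blk_ord blk_ge0 // eq_sym ba.
exact: (@le_bigmax _ _ _ _ (fun j => - U (Ordinal n_gt0) j j)).
Qed.

Context {K : nat}.
Hypothesis le_nK : (n <= K)%N.

Let T := btoep (zero_ext K U).
Let H := bcirc (zero_ext K U) - T.

Lemma btoep_zero_extE u t : T u t = (if (blkrow u <= blkrow t)%N then
    blk U (blkrow t - blkrow u) (inrow u) (inrow t) else 0).
Proof. by rewrite /T btoepE blk_zero_ext. Qed.

(** On and above the block diagonal the residue (j - i) mod K is j - i and the two matrices agree;
    below it the residue is K + j - i, and [H] keeps this wrapped part. *)
Lemma wrap_zero_extE u t : H u t = (if (blkrow t < blkrow u)%N then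
    blk U (K + blkrow t - blkrow u) (inrow u) (inrow t) else 0).
Proof.
have -> : H u t = bcirc (zero_ext K U) u t - T u t by rewrite !mxE.
rewrite btoep_zero_extE bcircE blk_zero_ext //.
have lt_uK : (blkrow u < K)%N by exact: ltn_ord.
have lt_tK : (blkrow t < K)%N by exact: ltn_ord.
case: leqP => [le_ut|lt_tu].
  by rewrite -addnBAC // modnDr modn_small ?subrr //;
    apply: leq_ltn_trans (leq_subr _ _) _.
by rewrite subr0 modn_small [(blkrow t + K)%N]addnC //; lia.
Qed.

Lemma btoep_zero_ext_offdiag_ge0 u t : u != t -> 0 <= T u t.
Proof.
move=> ut; rewrite btoep_zero_extE; case: ifP => // le_ut; apply: blk_ge0.
rewrite subn_gt0 ltn_neqAle le_ut andbT -negb_and; apply: contra ut.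
move=> /andP[/eqP /val_inj e1 /eqP e2].
by rewrite -(bidxK u) -(bidxK t) e1 e2.
Qed.

Lemma wrap_zero_ext_ge0 u t : 0 <= H u t.
Proof.
rewrite wrap_zero_extE; case: ifP => // lt_tu; apply: blk_ge0.
by rewrite subn_gt0 ltn_addr.
Qed.

(** Each block row of the circulant matrix is a cyclic shift of all the blocks, so its row sums are
    those of the first block row of [btoep U]. *)
Lemma rowsum_bcirc_zero_ext_le0 u : \sum_t (T + H) u t <= 0.
Proof.
rewrite /H subrKC.
under eq_bigr do rewrite bcircE blk_zero_ext //.
rewrite (big_bidx (fun j b => blk U ((j + K - blkrow u) %% K) (inrow u) b)).
rewrite (@sum_cyclic_shift _ K (blkrow u) (fun l => rsum l (inrow u))) //.
rewrite (big_nat_oversize le_nK) => [|k]; first exact: sum_rsum_le0.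
exact: rsum_oversize.
Qed.

Context {s : R}.
Hypothesis s_gt1 : 1 < s.

Let s_ge0 : 0 <= s := ltW (lt_trans ltr01 s_gt1).

(** Let x be the row sum of block 0, Q >= 0 the sum of the later ones and S = s^(n-1). Nonzero later
    terms carry a power at most S, and Q <= -x, so the total is at most x + S Q <= -x (S - 1) <=
    alpha (S - 1). *)
Lemma sum_rsum_expr_le p a : (0 < p)%N ->
  \sum_(0 <= l < p) rsum l a * s ^+ l <=
    max_neg_diag (U (Ordinal n_gt0)) * (s ^+ n.-1 - 1).
Proof.
case: p => // p _; rewrite big_ltn // expr0 mulr1 big_add1 /=.
have sn1 : 0 <= s ^+ n.-1 - 1 by rewrite subr_ge0 exprn_ege1 // ltW.
have rs0 : \sum_(0 <= l < p) rsum l.+1 a <= - rsum 0 a.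
  rewrite lerNr -subr_le0 opprK.
  apply: le_trans (sum_rsum_le0 a).
  (* The range up to [p.+1 + n] contains both that of the hypothesis and that of the truncated sum,
     which avoids comparing [p.+1] with [n]. *)
  rewrite -(@big_nat_oversize _ _ (p.+1 + n) (fun k => rsum k a)); last 2 first.
  - exact: leq_addl.
  - by move=> k; exact: rsum_oversize.
  rewrite (big_cat_nat (leq0n _) (leq_addr n p.+1)) /=.
  rewrite [X in _ <= X + _]big_ltn // big_add1 /=.
  rewrite lerDl big_nat; apply: sumr_ge0 => k /andP[pk _].
  by apply: rsum_ge0; apply: leq_trans pk.
apply: (@le_trans _ _ (rsum 0 a + s ^+ n.-1 * \sum_(0 <= l < p) rsum l.+1 a)).
  rewrite lerD2l mulr_sumr; apply: ler_sum => l _.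
  have [lt_ln|le_nl] := ltnP l.+1 n; last by rewrite rsum_oversize // mul0r mulr0.
  by rewrite mulrC ler_wpM2r ?rsum_ge0 // ler_weXn2l ?ltW //; lia.
have /= := oppr_rsum0_le a; have : 0 <= s ^+ n.-1 by rewrite exprn_ge0.
move: rs0 sn1; set Q := \sum_(0 <= l < p) _; set x := rsum 0 a.
set S := s ^+ n.-1; set al := max_neg_diag _; nra.
Qed.

(** With l = j - i, the weight s^j is s^l s^i: the factor s^i leaves the sum, and a truncated sum of
    the previous kind remains. *)
Lemma rowsum_btoep_zero_ext_le u :
  \sum_t T u t * s ^+ blkrow t <=
    max_neg_diag (U (Ordinal n_gt0)) * (s ^+ n.-1 - 1) * s ^+ blkrow u.
Proof.
pose g (j : nat) b := (if (blkrow u <= j)%N then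
    blk U (j - blkrow u) (inrow u) b else 0) * s ^+ j.
have lt_uK : (blkrow u < K)%N by exact: ltn_ord.
have -> : \sum_t T u t * s ^+ blkrow t =
    (\sum_(0 <= l < K - blkrow u) rsum l (inrow u) * s ^+ l) * s ^+ blkrow u.
  under eq_bigr do rewrite btoep_zero_extE.
  rewrite (big_bidx (fun j : 'I_K => g j)).
  rewrite -(big_mkord xpredT (fun j => \sum_b g j b)).
  rewrite (big_cat_nat (leq0n _) (ltnW lt_uK)) /= big_nat big1 ?add0r; last first.
    by move=> j /andP[_ ju]; apply: big1 => b _; rewrite /g leqNgt ju mul0r.
  rewrite -{1}[blkrow u : nat]add0n big_addn mulr_suml; apply: eq_bigr => l _.
  rewrite mulr_suml mulr_suml; apply: eq_bigr => b _.
  by rewrite /g leq_addl addnK exprD mulrA.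
by rewrite ler_wpM2r ?exprn_ge0 // sum_rsum_expr_le // subn_gt0.
Qed.

Lemma rowsum_wrap_zero_ext_le u :
  \sum_t H u t <= normInf (wrapL U) * s ^- (K - n) * s ^+ blkrow u.
Proof.
pose g (j : nat) b := if (j < blkrow u)%N then
    blk U (K + j - blkrow u) (inrow u) b else 0.
have lt_uK : (blkrow u < K)%N by exact: ltn_ord.
have L_ge0 := normInf_ge0 (wrapL U).
under eq_bigr do rewrite wrap_zero_extE.
rewrite (big_bidx (fun j : 'I_K => g j)).
rewrite -(big_mkord xpredT (fun j => \sum_b g j b)).
have s_neq0 : s != 0 by rewrite gt_eqF // (lt_trans ltr01).
(* A nonzero block of [H] at (i, j) requires K + j - i < n, so the block rows i <= K - n vanish. *)
have [le_u|lt_u] := leqP (blkrow u) (K - n).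
  rewrite big_nat big1 => [|j /andP[_ ltj]].
    by rewrite !mulr_ge0 ?invr_ge0 ?exprn_ge0.
  apply: big1 => b _; rewrite /g; case: ifP => // _.
  by rewrite blk_oversize ?mxE //; lia.
(* Block row i > K - n of [H] is block row i - (K - n) of [wrapL U] padded with zeros. Its row sums
   are thus at most the norm of [wrapL U], and s^(i - (K - n)) >= 1 supplies the weight. *)
have lt_i : (blkrow u - (K - n) < n)%N by lia.
apply: (@le_trans _ _ (normInf (wrapL U))); last first.
  by rewrite -mulrA ler_peMr // mulrC -expfB // exprn_ege1 // ltW.
apply: le_trans (normInf_rowsum (wrapL U) (bidx (Ordinal lt_i) (inrow u))).
under [leRHS]eq_bigr do rewrite wrapLE blkrow_bidx inrow_bidx.
pose g' (j : nat) b := if (j < blkrow u - (K - n))%N then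
    blk U (n + j - (blkrow u - (K - n))) (inrow u) b else 0.
rewrite (big_bidx (fun j : 'I_n => g' j)).
rewrite -(big_mkord xpredT (fun j => \sum_b g' j b)).
rewrite (big_nat_oversize le_nK) => [|k le_nk].
  rewrite le_eqVlt; apply/orP; left; apply/eqP.
  apply: eq_big_nat => j /andP[_ ltj]; apply: eq_bigr => b _.
  rewrite /g /g'; case: (ltnP j (blkrow u - (K - n))) => ju.
    rewrite ifT; last by lia.
    by congr (blk U _ _ _); lia.
  by case: ifP => // _; rewrite blk_oversize ?mxE //; lia.
apply: big1 => b _; rewrite /g; case: ifP => // _.
by rewrite blk_oversize ?mxE //; lia.
Qed.

End BlockSubgenerator.

(** * Embedding of the n-block matrix and conclusion *)

Definition widen_bidx (m n K : nat) (le_nK : (n <= K)%N)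
    (u : 'I_(\sum_(i < n) m)) : 'I_(\sum_(i < K) m) :=
  bidx (widen_ord le_nK (blkrow u)) (inrow u).

Lemma widen_bidx_inj (m n K : nat) (le_nK : (n <= K)%N) :
  injective (@widen_bidx m n K le_nK).
Proof.
move=> u t e; have := congr1 (@blkrow m K) e; have := congr1 (@inrow m K) e.
rewrite !blkrow_bidx !inrow_bidx => eqr /(congr1 val) /= /val_inj eqb.
by rewrite -(bidxK u) -(bidxK t) eqr eqb.
Qed.

(** Block upper triangularity makes the first n block coordinates stable, and the restriction to
    them is [btoep U]. *)
Lemma expmx_btoep_zero_ext (R : realType) (m n K : nat) (le_nK : (n <= K)%N)
    (U : 'I_n -> 'M[R]_m) u t :
  expmx (btoep (zero_ext K U)) (widen_bidx le_nK u) (widen_bidx le_nK t) =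
    expmx (btoep U) u t.
Proof.
apply: expmx_inj_sub => [|{}u {}t u_out|{}u {}t]; first exact: widen_bidx_inj.
  rewrite btoepE blkrow_bidx inrow_bidx ifF //; apply/negbTE.
  apply: contraNN u_out => le_ut.
  have lt_un : (blkrow u < n)%N.
    by apply: leq_ltn_trans le_ut _; exact: (ltn_ord (blkrow t)).
  apply/codomP; exists (bidx (Ordinal lt_un) (inrow u)).
  rewrite /widen_bidx blkrow_bidx inrow_bidx -[LHS]bidxK; congr bidx.
  exact: val_inj.
by rewrite !btoepE !blkrow_bidx !inrow_bidx /= blk_zero_ext.
Qed.

Lemma expmx_bcirc_sub_btoep (R : realType) (m n K : nat) (n_gt0 : (0 < n)%N)
    (le_nK : (n <= K)%N) (U : 'I_n -> 'M[R]_m) (s : R)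
    (T := btoep (zero_ext K U)) (C := bcirc (zero_ext K U)) :
  subgenerator (btoep U) -> 1 < s ->
  (forall u t, expmx T u t <= expmx C u t) /\
  (forall u, \sum_t (expmx C u t - expmx T u t) <=
     normInf (wrapL U) * s ^- (K - n) *
     expR (max_neg_diag (U (Ordinal n_gt0)) * (s ^+ n.-1 - 1)) * s ^+ blkrow u).
Proof.
move=> hU s_gt1.
have s_gt0 : 0 < s := lt_trans ltr01 s_gt1.
rewrite -[C](subrKC T).
apply: (@rowsum_expmx_perturb _ _ T (C - T) (fun u => s ^+ blkrow u)).
- exact: (btoep_zero_ext_offdiag_ge0 n_gt0 hU le_nK).
- exact: (wrap_zero_ext_ge0 n_gt0 hU le_nK).
- exact: (rowsum_bcirc_zero_ext_le0 n_gt0 hU le_nK).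
- by move=> u; rewrite exprn_ge0 // ltW.
- by rewrite mulr_ge0 ?normInf_ge0 ?invr_ge0 ?exprn_ge0 // ltW.
- by rewrite mulr_ge0 ?max_neg_diag_ge0 // subr_ge0 exprn_ege1 // ltW.
- exact: (rowsum_btoep_zero_ext_le n_gt0 hU le_nK s_gt1).
- exact: (rowsum_wrap_zero_ext_le n_gt0 le_nK s_gt1).
Qed.

Theorem theorem11 (R : realType) (m n K : nat) (n_gt0 : (0 < n)%N)
    (le_nK : (n <= K)%N)
    (U A : 'I_n -> 'M[R]_m) (S : 'I_K -> 'M[R]_m)
    (hU : subgenerator (btoep U))
    (hA : expmx (btoep U) = btoep A)
    (hS : expmx (bcirc (zero_ext K U)) = bcirc S) :
  (forall (i : 'I_n) (a b : 'I_m), 0 <= (S (widen_ord le_nK i) - A i) a b) /\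
  (forall s : R, 1 < s ->
     normInf (\mxrow_(i < n) (S (widen_ord le_nK i) - A i))
       <= fbound K U n_gt0 s).
Proof.
have K_gt0 : (0 < K)%N := leq_trans n_gt0 le_nK.
set T := btoep (zero_ext K U); set C := bcirc (zero_ext K U).
(* In the first block row the weight s^0 is 1. *)
pose row0 a : 'I_(\sum_(i < K) m) := bidx (Ordinal K_gt0) a.
have SA_E a (t : 'I_(\sum_(i < n) m)) :
    (S (widen_ord le_nK (blkrow t)) - A (blkrow t)) a (inrow t) =
    expmx C (row0 a) (widen_bidx le_nK t) - expmx T (row0 a) (widen_bidx le_nK t).
  have -> : expmx T (row0 a) (widen_bidx le_nK t) = A (blkrow t) a (inrow t).
    have -> : row0 a = widen_bidx le_nK (bidx (Ordinal n_gt0) a).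
      rewrite /widen_bidx blkrow_bidx inrow_bidx /row0.
      by congr (bidx _ a); exact: val_inj.
    by rewrite expmx_btoep_zero_ext hA btoepE blkrow_bidx inrow_bidx subn0 blk_ord.
  have -> : expmx C (row0 a) (widen_bidx le_nK t) =
      S (widen_ord le_nK (blkrow t)) a (inrow t).
    rewrite /C hS bcircE !blkrow_bidx !inrow_bidx subn0 modnDr.
    by rewrite modn_small // blk_ord.
  by rewrite !mxE.
split=> [i a b|s s_gt1].
  (* The entrywise comparison does not involve [s]; the value 2 is an arbitrary choice above 1. *)
  have [le_TC _] := expmx_bcirc_sub_btoep n_gt0 le_nK hU (ltr1n R 2).
  have := SA_E a (bidx i b); rewrite blkrow_bidx inrow_bidx => ->.
  by rewrite subr_ge0.
have [le_TC sum_le] := expmx_bcirc_sub_btoep n_gt0 le_nK hU s_gt1.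
have s_gt0 : 0 < s := lt_trans ltr01 s_gt1.
have sV_lt1 : s^-1 < 1 by rewrite invf_lt1.
have L_ge0 := normInf_ge0 (wrapL U).
have sKn : s ^ (- K%:Z + n%:Z) = s ^- (K - n).
  by rewrite exprnN; congr (s ^ _); lia.
have bound_ge : normInf (wrapL U) * s ^- (K - n) *
    expR (max_neg_diag (U (Ordinal n_gt0)) * (s ^+ n.-1 - 1)) <= fbound K U n_gt0 s.
  rewrite /fbound sKn mulrAC; apply: ler_pM.
  - by rewrite mulr_ge0 ?expR_ge0.
  - by rewrite invr_ge0 exprn_ge0 // ltW.
  - by rewrite ler_wpM2r ?expR_ge0 // lerBrDl expR_ge1Dx.
  - have sV_ge0 : 0 <= s^-1 by rewrite invr_ge0 ltW.
    rewrite ler_peMr -?exprVn ?exprn_ge0 // invf_ge1 ?subr_gt0 //.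
    by rewrite gerBl.
(* The first goal, nonnegativity of the bound, comes from the default value 0 of the maximum. *)
apply/bigmax_leP; split=> [|a _].
  by apply: le_trans bound_ge; rewrite !mulr_ge0 ?expR_ge0 ?invr_ge0 ?exprn_ge0 // ltW.
apply: le_trans bound_ge.
have := sum_le (row0 a); rewrite blkrow_bidx expr0 mulr1; apply: le_trans.
apply: (@le_trans _ _ (\sum_t (expmx C (row0 a) (widen_bidx le_nK t) -
    expmx T (row0 a) (widen_bidx le_nK t)))).
  apply: ler_sum => t _; rewrite mxE ger0_norm; last first.
    by rewrite [leRHS]SA_E subr_ge0.
  by rewrite [leLHS]SA_E.
(* The S_i - A_i fill only the first n blocks of the row; by [le_TC] the remaining entries are
   nonnegative, so adding them only increases the sum. *)
rewrite (big_inj_codom (fun t => expmx C (row0 a) t - expmx T (row0 a) t)); last first.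
  exact: widen_bidx_inj.
rewrite [leRHS](bigID (mem (codom (widen_bidx le_nK)))) /= lerDl.
by apply: sumr_ge0 => t _; rewrite subr_ge0.
Qed.
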